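(* Let $G$ be a group which has a non-abelian free subgroup whose cardinality is the same as that of $G$, and suppose that $G$ satisfies condition $(\ast)$. If $R$ is a domain with $|R|\le |G|$, then the group ring $RG$ of $G$ over $R$ is primitive. In particular, the group algebra $KG$ is primitive for any field $K$ (with no restriction on $|K|$).
   Context: Condition $(\ast)$ on a group $G$: for every finite subset $M$ of $G\setminus\{1\}$ there exist three distinct elements $a,b,c\in G$ such that for every positive integer $m$, all $g_1,\dots,g_m\in M$ and all $x_1,\dots,x_m\in\{a,b,c\}$: if $(x_1^{-1}g_1x_1)\cdots(x_m^{-1}g_mx_m)=1$, then $x_i=x_{i+1}$ for some $i$ with $1\le i\le m-1$. A ring is (right) primitive if it has a faithful irreducible right module; equivalently, if it has a maximal right ideal containing no non-zero two-sided ideal. A domain is an associative ring with $1\neq 0$ and without zero divisors. *)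

(* Defs.v *)
From HB Require Import structures.
From mathcomp Require Import all_boot all_algebra finmap.
From mathcomp Require Import boolp classical_sets functions cardinality.
From mathcomp.multinomials Require Import monalg.

Set Implicit Arguments.
Unset Strict Implicit.
Unset Printing Implicit Defensive.

Import GRing.Theory.
Local Open Scope fset_scope.
Local Open Scope ring_scope.

(* The additive group is that of finitely supported functions G -> R. The     *)
(* product that monalg puts on {malg R[G]} needs a monoid in which x * y = 1  *)
(* only if x = y = 1, so it never applies to a nontrivial group; hence the    *)
(* alias, which carries the convolution product instead.                      *)
Definition group_ring (R : nzRingType) (G : groupType) : Type := {malg R[G]}.

Section GroupRing.
Variables (R : nzRingType) (G : groupType).
Local Notation RG := (group_ring R G).
Implicit Types f g h : RG.

HB.instance Definition _ := GRing.Lmodule.copy RG {malg R[G]}.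

Definition gr_single (a : R) (x : G) : RG := << a *g x >>.

Definition gr_one : RG := gr_single 1 1%g.

Definition gr_mul f g : RG :=
  \sum_(x <- msupp f) \sum_(y <- msupp g)
    gr_single (mcoeff x f * mcoeff y g) (x * y)%g.

Fact gr_single0 x : gr_single 0 x = 0.
Proof. exact: monalgU0. Qed.

Fact gr_singleD x a b : gr_single (a + b) x = gr_single a x + gr_single b x.
Proof. exact: (@monalgUD G R x a b). Qed.

Fact gr_mulw (d1 d2 : {fset G}) f g :
  msupp f `<=` d1 -> msupp g `<=` d2 ->
  gr_mul f g = \sum_(x <- d1) \sum_(y <- d2)
    gr_single (mcoeff x f * mcoeff y g) (x * y)%g.
Proof.
move=> le1 le2; rewrite /gr_mul (big_fset_incl _ le1) /=.
  apply: eq_bigr => x _; apply/big_fset_incl => // y _ /mcoeff_outdom ->.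
  by rewrite mulr0 gr_single0.
move=> x _ /mcoeff_outdom fx; rewrite big1 // => y _.
by rewrite fx mul0r gr_single0.
Qed.

Fact gr_mulDl : left_distributive gr_mul +%R.
Proof.
move=> f1 f2 g.
rewrite (gr_mulw (msuppD_le f1 f2) (fsubset_refl (msupp g))).
rewrite (gr_mulw (fsubsetUl (msupp f1) (msupp f2)) (fsubset_refl (msupp g))).
rewrite (gr_mulw (fsubsetUr (msupp f1) (msupp f2)) (fsubset_refl (msupp g))).
rewrite -big_split; apply: eq_bigr => x _.
rewrite -big_split; apply: eq_bigr => y _ /=.
by rewrite mcoeffD mulrDl gr_singleD.
Qed.

Fact gr_mulDr : right_distributive gr_mul +%R.
Proof.
move=> f g1 g2.
rewrite (gr_mulw (fsubset_refl (msupp f)) (msuppD_le g1 g2)).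
rewrite (gr_mulw (fsubset_refl (msupp f)) (fsubsetUl (msupp g1) (msupp g2))).
rewrite (gr_mulw (fsubset_refl (msupp f)) (fsubsetUr (msupp g1) (msupp g2))).
rewrite -big_split; apply: eq_bigr => x _.
rewrite -big_split; apply: eq_bigr => y _ /=.
by rewrite mcoeffD mulrDr gr_singleD.
Qed.

Fact gr_mul0 g : gr_mul 0 g = 0.
Proof. by apply: (addIr (gr_mul 0 g)); rewrite -gr_mulDl !add0r. Qed.

Fact gr_mulr0 g : gr_mul g 0 = 0.
Proof. by apply: (addIr (gr_mul g 0)); rewrite -gr_mulDr !add0r. Qed.

Fact gr_mul_single a b x y :
  gr_mul (gr_single a x) (gr_single b y) = gr_single (a * b) (x * y)%g.
Proof.
rewrite (gr_mulw (@msuppU_le _ _ x a) (@msuppU_le _ _ y b)).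
by rewrite !big_seq_fset1 !mcoeffUU.
Qed.

Fact gr_sumE f : f = \sum_(x <- msupp f) gr_single (mcoeff x f) x.
Proof. exact: monalgE. Qed.

Fact gr_mul_suml I (r : seq I) (F : I -> RG) g :
  gr_mul (\sum_(i <- r) F i) g = \sum_(i <- r) gr_mul (F i) g.
Proof. exact: (big_morph (gr_mul^~ g) (fun _ _ => gr_mulDl _ _ _) (gr_mul0 g)). Qed.

Fact gr_mul_sumr I (r : seq I) (F : I -> RG) g :
  gr_mul g (\sum_(i <- r) F i) = \sum_(i <- r) gr_mul g (F i).
Proof. exact: (big_morph (gr_mul g) (fun _ _ => gr_mulDr _ _ _) (gr_mulr0 g)). Qed.

Fact gr_mulA : associative gr_mul.
Proof.
move=> f g h; rewrite (gr_sumE f) (gr_sumE g) (gr_sumE h).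
rewrite [RHS]gr_mul_sumr.
under [RHS]eq_bigr => z _ do rewrite !gr_mul_suml.
rewrite gr_mul_suml [RHS]exchange_big /=; apply: eq_bigr => x _.
under [RHS]eq_bigr => z _ do rewrite gr_mul_sumr gr_mul_suml.
rewrite [RHS]exchange_big /= gr_mul_suml gr_mul_sumr; apply: eq_bigr => y _.
rewrite [gr_mul (gr_single _ y) _]gr_mul_sumr gr_mul_sumr; apply: eq_bigr => z _.
by rewrite !gr_mul_single mulrA mulgA.
Qed.

Fact gr_mul1 : left_id gr_one gr_mul.
Proof.
move=> f; rewrite {1}(gr_sumE f) gr_mul_sumr [RHS]gr_sumE.
by apply: eq_bigr => x _; rewrite gr_mul_single mul1r mul1g.
Qed.

Fact gr_mulr1 : right_id gr_one gr_mul.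
Proof.
move=> f; rewrite {1}(gr_sumE f) gr_mul_suml [RHS]gr_sumE.
by apply: eq_bigr => x _; rewrite gr_mul_single mulr1 mulg1.
Qed.

Fact gr_one_neq0 : gr_one != 0.
Proof. by rewrite monalgU_eq0 oner_eq0. Qed.

HB.instance Definition _ := GRing.Zmodule_isNzRing.Build RG
  gr_mulA gr_mul1 gr_mulr1 gr_mulDl gr_mulDr gr_one_neq0.

End GroupRing.

Local Open Scope classical_set_scope.

(* R is not required to be commutative, unlike an idomainType; 1 != 0 is part *)
(* of nzRingType.                                                             *)
Definition is_domain (R : nzRingType) : Prop := GRing.integral_domain_axiom R.

(* A right S-module is a left module over the converse ring S^c: a *: v       *)
(* stands for v.a, and (a * b) *: v = b *: (a *: v) when a * b is computed    *)
(* in S.                                                                      *)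
Definition irreducible_module (S : nzRingType) (M : lmodType S) : Prop :=
  (exists v : M, v != 0) /\
  forall N : set M, GRing.submod_closed (mem N) -> N = [set 0] \/ N = setT.

Definition faithful_module (S : nzRingType) (M : lmodType S) : Prop :=
  forall a : S, (forall v : M, a *: v = 0) -> a = 0.

Definition right_primitive (S : nzRingType) : Prop :=
  exists M : lmodType S^c, faithful_module M /\ irreducible_module M.

Section Groups.
Variable G : groupType.
Implicit Types (B H : set G) (w : seq (G * bool)).
Local Open Scope group_scope.

(* The letter (x, false) stands for x and (x, true) for x^-1.                 *)
Definition word_eval w : G :=
  \prod_(l <- w) (if l.2 then l.1^-1 else l.1).

Definition word_on B w : Prop := forall l, l \in w -> B l.1.

Definition reduced w : bool :=
  sorted (fun l l' => (l.1 == l'.1) ==> (l.2 == l'.2)) w.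

Definition free_basis B H : Prop :=
  B `<=` H /\
  forall h, H h ->
    exists! w, [/\ word_on B w, reduced w & word_eval w = h].

Definition free_subgroup H : Prop :=
  group_closed (mem H) /\ exists B, free_basis B H.

Definition nonabelian H : Prop :=
  exists x y, [/\ H x, H y & x * y <> y * x].

Definition condition_star : Prop :=
  forall M : {fset G}, 1 \notin M ->
  exists a b c : G, [/\ a != b, a != c & b != c] /\
  forall (m : nat) (g x : nat -> G), (0 < m)%N ->
    (forall i, (1 <= i <= m)%N -> g i \in M) ->
    (forall i, (1 <= i <= m)%N -> x i \in [:: a; b; c]) ->
    \prod_(1 <= i < m.+1) ((x i)^-1 * g i * x i) = 1 ->
    exists i, (1 <= i <= m.-1)%N /\ x i = x i.+1.

End Groups.

(* Main.v *)
(* Proof idea. To each admissible [f <> 0] attach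
     [eps f = \sum_(k < 3, j < 5) L(f,k,j) f a_k],
   where the [a_k] come from condition (star) for the support of [f] and the [L(f,k,j)]
   are distinct members of a free family. An element [f] of a two-sided ideal puts
   [eps f] into it, so it suffices to see that the right ideal generated by the
   [eps f + 1] is proper; a maximal right ideal containing it then contains no nonzero
   two-sided ideal.
   Suppose [\sum_f (eps f + 1) r_f = 1]. By (star), for each [f] the supports of the three
   products [f a_k r_f] contain together at least as many elements as that of [r_f]. Let
   [N] be the number of all these elements [h], and consider their [5 N] translates
   [L(f,k,j) h]. By ping-pong, at least four of the five translates of [h] are good: good
   translates are pairwise distinct, so each of the at most [N] bad ones cancels at most
   one of them. Hence at least [3 N] group elements have to be cancelled by the [r_f] or
   be equal to 1. As the supports of the [r_f] have at most [N] elements in all, this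
   gives [3 N <= N + 1], so [N = 0] and all [r_f] vanish.
   The [L(f,k,j)] exist because the [f] can be encoded by words in a free basis. For a
   field of arbitrary size it is enough to take the [f] with integral coefficients,
   since these meet every nonzero ideal. *)

Require Import Defs.
From HB Require Import structures.
From mathcomp Require Import all_boot all_algebra.
From mathcomp Require Import generic_quotient ring_quotient finmap zify.
From mathcomp Require Import boolp classical_sets functions cardinality.
From mathcomp.multinomials Require Import monalg.

Set Implicit Arguments.
Unset Strict Implicit.
Unset Printing Implicit Defensive.

Import GRing.Theory.
Local Open Scope quotient_scope.
Local Open Scope classical_set_scope.
Local Open Scope card_scope.

(** * Words *)

Section PrefixCode.
Variables (T : eqType) (x y : T).
Implicit Types (s t : seq T) (ss : seq (seq T)).

(* The letter [y] marks the end, and [x] announces one more letter: no code is a proper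
   prefix of another. *)
Definition pcode s : seq T := foldr (fun b w => [:: x, b & w]) [:: y] s.

Lemma pcode_cat_inj s1 s2 t1 t2 : x != y ->
  pcode s1 ++ t1 = pcode s2 ++ t2 -> s1 = s2 /\ t1 = t2.
Proof.
move=> /eqP xy; elim: s1 s2 => [|b1 s1 IH] [|b2 s2] /=.
- by case.
- by case=> /esym.
- by case.
- by case=> -> /IH[-> ->].
Qed.

(** Packs a list of words into one word over the same alphabet; nested uses encode structured
    data. *)
Definition lcode ss : seq T := flatten (map pcode ss).

Lemma lcode_inj : x != y -> injective lcode.
Proof.
move=> xy; elim=> [|s1 ss1 IH] [|s2 ss2] //.
- by case: s2.
- by case: s1.
- by rewrite /lcode /= => /(pcode_cat_inj xy)[-> /IH ->].
Qed.

End PrefixCode.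

Lemma sorted_cat_rcons (T : Type) (e : rel T) (s1 s2 : seq T) (l1 l2 : T) :
  sorted e (rcons s1 l1) -> sorted e (l2 :: s2) -> e l1 l2 ->
  sorted e (rcons s1 l1 ++ l2 :: s2).
Proof.
case: s1 => [|l s1] /= h1 h2 h12; first by rewrite h12.
by rewrite cat_path h1 last_rcons /= h12.
Qed.

Section FreeWords.
Variable G : groupType.
Implicit Types (s p q : seq G) (w : seq (G * bool)) (B : set G).
Local Open Scope group_scope.

Definition pos_word s : seq (G * bool) := [seq (b, false) | b <- s].
Definition neg_word s : seq (G * bool) := [seq (b, true) | b <- rev s].

Lemma word_eval_cat w1 w2 : word_eval (w1 ++ w2) = word_eval w1 * word_eval w2.
Proof. by rewrite /word_eval big_cat. Qed.

Lemma word_eval_neg s : word_eval (neg_word s) = (word_eval (pos_word s))^-1.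
Proof.
elim: s => [|b s IH]; first by rewrite /word_eval !big_nil invg1.
rewrite /neg_word rev_cons map_rcons -cats1 word_eval_cat IH.
rewrite -[pos_word (b :: s)]/([:: (b, false)] ++ pos_word s) word_eval_cat invgM.
by rewrite /word_eval !big_seq1.
Qed.

Lemma reduced_const (e : bool) s : reduced [seq (b, e) | b <- s].
Proof.
rewrite /reduced; case: s => [|b s] //=; elim: s b => [|c s IH] b //=.
by rewrite eqxx implybT IH.
Qed.

(** The condition on the heads makes [a] the longest common prefix, that is, the part that cancels
    in [q^-1 w]. *)
Lemma split_common_prefix q w : exists a b w',
  [/\ q = a ++ b, w = pos_word a ++ w' &
      forall b1 l, ohead b = Some b1 -> ohead w' = Some l -> l != (b1, false)].
Proof.
elim: q w => [|c q IH] w; first by exists [::], [::], w.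
case: w => [|l w]; first by exists [::], (c :: q), [::].
have [->|ne] := eqVneq l (c, false).
  have [a [b [w' [-> -> h]]]] := IH w.
  by exists (c :: a), b, w'.
exists [::], (c :: q), (l :: w); split=> // b1 l' [<-] [<-] //.
Qed.

Lemma reduced_catr w1 w2 : reduced (w1 ++ w2) -> reduced w2.
Proof. by rewrite /reduced => /cat_sorted2[]. Qed.

(* [p] and [q] end in different letters, so that in [p q^-1 w] cancellation can
   only take place between [q^-1] and [w]; it stops before it reaches [p] unless
   [w] starts with [q]. *)
Lemma reduced_word_mul x y p q w : x != y -> reduced w ->
  ~~ prefix (pos_word (rcons q y)) w ->
  exists2 w', [/\ reduced w', prefix (pos_word (rcons p x)) w' &
      word_eval w' =
      word_eval (pos_word (rcons p x)) * (word_eval (pos_word (rcons q y)))^-1 * word_eval w]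
    & forall l, l \in w' -> l.1 \in rcons p x ++ rcons q y ++ [seq l.1 | l <- w].
Proof.
move=> xy rw npre.
have [a [b [w' [eq_q eq_w hd]]]] :=
  split_common_prefix (rcons q y) w.
have [b1 [b2 eb]] : exists b1 b2, b = b1 :: b2.
  case: b eq_q {hd} => [|b1 b2] eq_q; last by exists b1, b2.
  by move: npre; rewrite eq_w eq_q cats0 prefix_prefix.
have [b' eb'] : exists b', b = rcons b' y.
  move: eq_q; rewrite eb; case: (lastP (b1 :: b2)) => [|c z]; last first.
    by rewrite -rcons_cat => /rcons_inj[_ ->]; exists c.
  by rewrite cats0 => e; exists [::] => //; move: npre; rewrite eq_w e prefix_prefix.
exists (pos_word (rcons p x) ++ neg_word b ++ w').
  split; last 1 first.
  - rewrite eq_q eq_w /pos_word map_cat !word_eval_cat word_eval_neg -/(pos_word a) -/(pos_word b).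
    by rewrite invgM !mulgA mulgVK.
  - rewrite /pos_word map_rcons.
    rewrite /neg_word eb' rev_rcons /=; apply: sorted_cat_rcons; first last.
    + by rewrite /= (negPf xy).
    + rewrite -[_ :: _]/([seq (b, true) | b <- y :: rev b'] ++ w') -rev_rcons -eb'.
      have rw' : reduced w' by apply: (@reduced_catr (pos_word a)); rewrite -eq_w.
      case: w' hd rw' {eq_w} => [|l w'] hd rw'.
        by rewrite cats0; apply: reduced_const.
      have := reduced_const true (rev b); rewrite eb rev_cons map_rcons => rb.
      apply: sorted_cat_rcons => //=.
      apply/implyP => /eqP e1; move: (hd b1 l); rewrite eb => /(_ erefl erefl).
      by case: l e1 {hd rw'} => l1 [] /= ->; rewrite ?eqxx.
    + by rewrite -map_rcons; apply: reduced_const.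
  - exact: prefix_prefix.
move=> l; rewrite !mem_cat => /or3P[/mapP[c ? ->]|/mapP[c]|lw'].
- by apply/orP; left.
- by rewrite mem_rev => cb ->; rewrite eq_q mem_cat cb !orbT.
- by rewrite eq_w map_cat mem_cat (map_f _ lw') !orbT.
Qed.

End FreeWords.

(** * Ping-pong for a free subgroup of full cardinality *)

Section PingPong.
Variable G : groupType.
Local Open Scope group_scope.

Lemma word_eval_commute (b : G) (w1 w2 : seq (G * bool)) :
  word_on [set b] w1 -> word_on [set b] w2 ->
  commute (word_eval w1) (word_eval w2).
Proof.
have letters (w : seq (G * bool)) g : word_on [set b] w -> commute b g ->
    commute (word_eval w) g.
  move=> hw bg; apply: commute_sym; rewrite /word_eval big_seq.
  apply: commute_prod => l /hw ->.
  by case: ifP => _; [apply: commuteV|]; apply: commute_sym.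
move=> hw1 hw2; apply: (letters) hw1 _.
by apply: commute_sym; apply: (letters) hw2 _.
Qed.

Lemma word_eval_closed (H B : set G) (w : seq (G * bool)) :
  group_closed (mem H) -> B `<=` H -> word_on B w -> word_eval w \in H.
Proof.
move=> gH BH Bw; rewrite /word_eval big_seq.
apply: (big_ind (fun g => g \in H)); first exact: gH.1.
  exact: (group_closedM gH).
move=> l /Bw/BH Hl; have {}Hl : l.1 \in H by rewrite in_setE.
by case: ifP => _ //; apply: (group_closedV gH).
Qed.

(** Choose a representative [t g] of each coset [H g] and let [nf g] be the reduced word of
    [g (t g)^-1]: left multiplication by [H] then acts as it does on [H] itself. On [H] the
    representative is constant, whence the injectivity. *)
Lemma exists_normal_form (H B : set G) : free_subgroup H -> free_basis B H ->
  exists nf : G -> seq (G * bool),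
    [/\ forall g, word_on B (nf g),
        forall g, reduced (nf g),
        {in H &, injective nf} &
        forall h w g, word_on B w -> reduced w -> H h ->
          word_eval w = h * word_eval (nf g) -> nf (h * g) = w].
Proof.
move=> [gH _] [_ BH].
have H1 : H 1 by have := gH.1; rewrite in_setE.
have HD g h : H g -> H h -> H (g * h^-1).
  by move=> Hg Hh; rewrite -in_setE; apply: gH.2; rewrite in_setE.
have HV h : H h -> H h^-1 by move=> Hh; rewrite -[h^-1]mul1g; apply: HD.
have HM g h : H g -> H h -> H (g * h).
  by move=> Hg Hh; rewrite -[h]invgK; apply: HD => //; apply: HV.
have /choice[rw rwP] : forall h, exists w, H h ->
    [/\ word_on B w, reduced w & word_eval w = h].
  move=> h; have [Hh|nHh] := EM (H h); last by exists [::].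
  by have [w [? _]] := BH _ Hh; exists w.
pose t g := xget 1 [set u | H (g * u^-1)].
have tP g : H (g * (t g)^-1).
  suff: [set u | H (g * u^-1)] (t g) by [].
  by rewrite /t; apply: xgetPex; exists g; rewrite /= mulgV.
(* The two sets of candidates coincide, and [xget] depends on nothing else. *)
have tM h g : H h -> t (h * g) = t g.
  move=> Hh; congr xget; apply/seteqP; split=> u /= Hu; last first.
    by rewrite -mulgA; apply: HM.
  by rewrite -(mulKg h (g * u^-1)); apply: HM; [apply: HV|rewrite mulgA].
exists (fun g => rw (g * (t g)^-1)); split.
- by move=> g; have [] := rwP _ (tP g).
- by move=> g; have [] := rwP _ (tP g).
- move=> h1 h2; rewrite !in_setE => Hh1 Hh2 e.
  have [_ _ e1] := rwP _ (tP h1); have [_ _ e2] := rwP _ (tP h2).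
  have tH h : H h -> t h = t 1 by move=> Hh; rewrite -{1}[h]mulg1 tM.
  by move: e1; rewrite e e2 (tH _ Hh1) (tH _ Hh2) => /mulIg.
- move=> h w g Bw rw_w Hh; have [_ _ ->] := rwP _ (tP g) => ew.
  rewrite tM //; have Hh' : H (h * g * (t g)^-1).
    by rewrite -mulgA; apply: HM.
  have [u [_ uniq_u]] := BH _ Hh'; rewrite -(uniq_u (rw _)); last exact: rwP.
  by apply: uniq_u; rewrite ew mulgA.
Qed.

(** If the basis had at most one element, all words would consist of one letter and its inverse,
    hence commute. *)
Lemma nonabelian_basis (H B : set G) : free_basis B H -> nonabelian H ->
  exists x y, [/\ B x, B y & x != y].
Proof.
move=> [_ BH] [g [h [Hg Hh ngh]]]; apply: contrapT => nxy; apply: ngh.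
have [w1 [[B1 _ <-] _]] := BH _ Hg; have [w2 [[B2 _ <-] _]] := BH _ Hh.
case: w1 B1 => [|l w1] B1; first by rewrite /word_eval big_nil mul1g mulg1.
have Bl x : B x -> x = l.1.
  move=> Bx; apply/eqP/negPn/negP => ne; apply: nxy; exists x, l.1.
  by split=> //; apply: B1; rewrite mem_head.
by apply: (@word_eval_commute l.1) => k kw; apply: Bl; [apply: B1|apply: B2].
Qed.

(* [L u] will be [p q^-1] with [p], [q] positive words coding [u], and [A u] the set of
   elements whose normal form starts with [p]. Since the codes are prefix-free, the [A u]
   are disjoint and the normal form of [h] starts with [q] for at most one [u]; for all
   other [u], the element [L u * h] lies in [A u]. *)
Lemma free_pingpong (H : set G) :
  free_subgroup H -> nonabelian H -> H #= [set: G] ->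
  exists (T : eqType) (x y : T) (code : G -> seq T) (L : seq T -> G)
    (A : seq T -> G -> bool),
    [/\ x != y, injective code,
        forall u u' v, A u v -> A u' v -> u = u' &
        forall u u' h, ~~ A u (L u * h) -> ~~ A u' (L u' * h) -> u = u'].
Proof.
move=> freeH nabH cardH; have [_ [B BH]] := freeH.
have [x [y [Bx By xy]]] := nonabelian_basis BH nabH.
have [nf [Bnf rednf injnf nfP]] := exists_normal_form freeH BH.
have memB b : B b -> b \in B by rewrite in_setE.
pose T := {b : G | b \in B}.
pose X : T := exist _ x (memB _ Bx); pose Y : T := exist _ y (memB _ By).
have XY : X != Y by rewrite -(inj_eq val_inj).
(* Normal forms are known to be injective only on [H], so [G] is first moved into [H]. *)
have [f [fH finj]] : exists f : G -> G, (forall g, H (f g)) /\ injective f.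
  have : [set: G] #<= H by have := cardH; rewrite card_eq_sym => /card_eqPle[].
  rewrite /card_le => /asboolP[F].
  exists (fun g => val (F (exist _ g (mem_set I : g \in [set: G])))).
  split=> [g|g h /val_inj]; first by rewrite -in_setE; apply: valP.
  by move=> /(@inj _ _ _ F _ _ (in_setT _) (in_setT _))[].
have lift_word (w : seq (G * bool)) : word_on B w ->
    exists w' : seq (T * bool), w = [seq (val l.1, l.2) | l <- w'].
  elim: w => [|[b e] w IH] Bw; first by exists [::].
  have [w' ->] := IH (fun l lw => Bw l (@mem_behead _ (_ :: _) _ lw)).
  have Bb : b \in B by apply: (memB b); apply: (Bw (b, e)); rewrite mem_head.
  by exists ((exist _ b Bb, e) :: w').
have [nfT nfTP] := choice (fun g => lift_word _ (Bnf g)).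
pose code g := lcode X Y
  [:: map fst (nfT (f g)); [seq if l.2 then X else Y | l <- nfT (f g)]].
pose p u := rcons (pcode X Y u) X; pose q u := rcons (pcode X Y u) Y.
pose P u := pos_word (map val (p u)); pose Q u := pos_word (map val (q u)).
(* [P u] and [Q u] extend [C u] by one letter, [x] and [y] respectively; comparing the
   self-delimiting parts [C u] therefore suffices. *)
pose C u := pos_word (map val (pcode X Y u)).
have prefC u w : prefix (P u) w || prefix (Q u) w -> prefix (C u) w.
  have PC z : prefix (C u) (pos_word (map val (rcons (pcode X Y u) z))).
    by rewrite /C /pos_word !map_rcons -cats1 prefix_prefix.
  by case/orP; apply: prefix_trans; apply: PC.
have prefP u u' w : prefix (P u) w || prefix (Q u) w ->
    prefix (P u') w || prefix (Q u') w -> u = u'.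
  move=> /prefC cu /prefC cu'.
  wlog le : u u' cu cu' / size (C u) <= size (C u').
    by move=> IH; case: (leqP (size (C u)) (size (C u'))) => [|/ltnW] le;
      [|apply/esym]; apply: IH.
  have : C u = take (size (C u)) (C u').
    move: cu cu'; rewrite !prefixE => /eqP {1}<- /eqP <-.
    by rewrite take_takel.
  rewrite /C /pos_word -!map_comp -map_take => /inj_map e.
  have {}e : pcode X Y u ++ drop (size (C u)) (pcode X Y u') = pcode X Y u' ++ [::].
    rewrite cats0 e; last by move=> a b [] /val_inj.
    by rewrite /C /pos_word -!map_comp size_map cat_take_drop.
  by have [] := pcode_cat_inj XY e.
exists T, X, Y, code, (fun u => word_eval (P u) * (word_eval (Q u))^-1),
  (fun u v => prefix (P u) (nf v)); split=> //.
- move=> g h /(lcode_inj XY)[e1 e2]; apply: finj; apply: injnf; rewrite ?in_setE //.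
  rewrite !nfTP; congr map.
  elim: (nfT (f g)) (nfT (f h)) e1 e2 => [|[b e] w IH] [|[b' e'] w'] //=.
  case=> -> /IH{}IH [ee' /IH ->]; congr ((_, _) :: _).
  by case: e e' ee' => [] [] // /eqP; rewrite ?(negPf XY) // eq_sym (negPf XY).
- by move=> u u' v pu pu'; apply: (prefP _ _ (nf v)); rewrite ?pu ?pu'.
- move=> u u' h nPu nPu'.
  suff Qh v : ~~ prefix (P v) (nf (word_eval (P v) * (word_eval (Q v))^-1 * h)) ->
      prefix (Q v) (nf h).
    by apply: (prefP _ _ (nf h)); rewrite ?(Qh u) ?(Qh u') ?orbT.
  apply: contraR => nQ.
  have BV (s : seq T) b : b \in map val s -> B b.
    by case/mapP => c _ ->; rewrite -in_setE; apply: valP.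
  have Hpos (s : seq T) : word_eval (pos_word (map val s)) \in H.
    apply: (@word_eval_closed H B); [exact: freeH.1 | exact: BH.1 |].
    by move=> l /mapP[b /BV Bb ->].
  move: nQ (Hpos (p v)) (Hpos (q v)).
  rewrite /P /Q /p /q !map_rcons => nQ HP HQ.
  have [w [rw Pw ew] lw] :=
    reduced_word_mul (map val (pcode X Y v)) xy (rednf h) nQ.
  rewrite (nfP _ w) //.
  + move=> l /lw; rewrite !mem_cat !mem_rcons !inE -!orbA.
    case/or3P=> [/eqP-> //|/BV //|/or3P[/eqP-> //|/BV //|]].
    by case/mapP => k /Bnf Bk ->.
  + by rewrite -in_setE; apply: (freeH.1).2.
Qed.

End PingPong.

(** * Counting *)

Section Counting.
Local Open Scope nat_scope.

(* A vertex outside [V0] of the form [F t i] with [ok t i] is also hit by some [F t' j] with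
   [~~ ok t' j], and there are at most [size X] of the latter. *)
Lemma few_stars (S V : eqType) (F : S -> 'I_5 -> V) (ok : S -> 'I_5 -> bool)
    (X : seq S) (V0 : seq V) : uniq X ->
  (forall t i j, t \in X -> ~~ ok t i -> ~~ ok t j -> i = j) ->
  (forall t i t' j, t \in X -> t' \in X -> ok t i -> ok t' j -> F t i = F t' j ->
     t = t' /\ i = j) ->
  (forall t i, t \in X -> F t i \notin V0 ->
     exists t' j, [/\ t' \in X, (t', j) <> (t, i) & F t' j = F t i]) ->
  3 * size X <= size V0.
Proof.
move=> uX bad1 okI twice.
(* If no index fails [ok], then [ord0] is discarded instead, so that exactly four good indices are
   kept in every case. *)
pose bad t : 'I_5 := odflt ord0 [pick j | ~~ ok t j].
have okN t j : t \in X -> j != bad t -> ok t j.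
  move=> tX; apply: contraNT => nok; rewrite /bad;
  case: pickP => [i nok_i|/(_ j)]; last by rewrite nok.
  by rewrite (bad1 _ _ _ tX nok nok_i).
pose good := [seq F t (lift (bad t) i) | t <- X, i <- enum 'I_4].
have good_uniq : uniq good.
  apply: allpairs_uniq => //; first exact: enum_uniq.
  have mem_pair t i : (t, i) \in [seq (t, i) | t <- X, i <- enum 'I_4] -> t \in X.
    by case/allpairsP => -[t' i'] [? _ [->]].
  move=> [t i] [t' j] /mem_pair tX /mem_pair t'X /= /okI[] //.
  - by apply: okN; rewrite // eq_sym neq_lift.
  - by apply: okN; rewrite // eq_sym neq_lift.
  - by move=> -> /lift_inj ->.
have : {subset good <= V0 ++ [seq F t (bad t) | t <- X]}.
  move=> _ /allpairsP[[t i] [tX _ ->]] /=; rewrite mem_cat.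
  case: (boolP (_ \in V0)) => //= nV0.
  have [t' [j [t'X ne e]]] := twice _ _ tX nV0.
  case: (eqVneq j (bad t')) => [ej|/(okN _ _ t'X) okj].
    by rewrite -e ej (map_f (fun t => F t (bad t))).
  have ok_i : ok t (lift (bad t) i) by apply: okN; rewrite // eq_sym neq_lift.
  by have [et ej] := okI _ _ _ _ t'X tX okj ok_i e; case: ne; rewrite et ej.
move/(uniq_leq_size good_uniq).
by rewrite size_cat size_map size_allpairs size_enum_ord; lia.
Qed.

(** The edges [e] join [p e] to [q e] in a bipartite graph in which every nonempty set of edges has
    a leaf. Deleting a leaf edge together with its end of degree 1 removes one edge and one
    vertex. *)
Lemma forest_size (E P Q : eqType) (p : E -> P) (q : E -> Q)
    (es : seq E) (ps : seq P) (qs : seq Q) : uniq es ->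
  (forall es' : seq E, {subset es' <= es} -> es' != [::] ->
     exists2 e, e \in es' &
       {in es', forall e', p e' = p e -> e' = e} \/
       {in es', forall e', q e' = q e -> e' = e}) ->
  {in es, forall e, p e \in ps} -> {in es, forall e, q e \in qs} ->
  size es <= size ps + size qs.
Proof.
elim: {es}_.+1 {-2}es (ltnSn (size es)) ps qs => // n IH es len ps qs ues leaf ps_es qs_es.
case: (eqVneq es [::]) => [-> //|es0].
have [e e_es e_leaf] := leaf es (fun _ => id) es0.
have sub : {subset rem e es <= es} := @mem_rem _ _ _.
have es_gt0 : 0 < size es by case: (es) es0.
have := IH (rem e es); rewrite size_rem // => {}IH.
have {}IH := IH _ _ _ (rem_uniq _ ues) (fun es' s => leaf es' (fun x h => sub _ (s x h))).
have ne e' : e' \in rem e es -> e' \in es /\ e' != e.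
  by rewrite mem_rem_uniq // !inE => /andP[].
have lt_n : (size es).-1 < n by lia.
case: e_leaf => leaf_e.
- have ps_gt0 : 0 < size ps by case: (ps) (ps_es _ e_es).
  suff : (size es).-1 <= size (rem (p e) ps) + size qs.
    by rewrite size_rem ?ps_es //; lia.
  apply: IH => // [e' /ne[h1 h2]|e' /sub]; last exact: qs_es.
  apply: rem_mem; last exact: ps_es.
  by apply: contraNneq h2 => /(leaf_e _ h1) ->.
- have qs_gt0 : 0 < size qs by case: (qs) (qs_es _ e_es).
  suff : (size es).-1 <= size ps + size (rem (q e) qs).
    by rewrite size_rem ?qs_es //; lia.
  apply: IH => // [e' /sub|e' /ne[h1 h2]]; first exact: ps_es.
  apply: rem_mem; last exact: qs_es.
  by apply: contraNneq h2 => /(leaf_e _ h1) ->.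
Qed.

(** Greedy choice: remove two adjacent vertices [u], [v], make [v] a centre and recurse. A vertex
    that thereby loses its last neighbour is adjacent to [u] or [v], so it is within two edges of
    [v]. Each centre is paid for by its own pair. *)
Lemma packing (T : eqType) (e : rel T) (s : seq T) :
  reflexive e -> symmetric e -> uniq s ->
  exists (c : seq T) (z : T -> T),
    2 * size c <= count (fun v => has (fun u => (u != v) && e v u) s) s /\
    {in s, forall v, has (fun u => (u != v) && e v u) s ->
       z v \in c /\ exists2 w, e v w & e w (z v)}.
Proof.
move=> refl_e sym_e.
elim: {s}_.+1 {-2}s (ltnSn (size s)) => // n IH s len us.
pose B s v := has (fun u => (u != v) && e v u) s; rewrite -!/(B _).
case: (boolP (has (B s) s)) => [/hasP[v vs /hasP[u us' /andP[uv evu]]]|nB]; last first.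
  exists [::], id; split=> // v vs Bv.
  by case/hasP: nB; exists v.
pose s' := [seq x <- s | x \notin [:: u; v]].
have ss' : {subset s' <= s} by move=> x; rewrite mem_filter => /andP[].
have us2 : uniq s' by rewrite filter_uniq.
have lt : size s' < size s.
  rewrite size_filter -(count_predC (fun x => x \notin [:: u; v]) s).
  rewrite -[ltnLHS]addn0 ltn_add2l -has_count; apply/hasP; exists u => //=.
  by rewrite !inE eqxx.
have [c' [z' [cs zP]]] := IH s' (leq_trans lt len) us2.
exists (v :: c'), (fun x => if (x \in s') && B s' x then z' x else v).
have BB x : B s' x -> B s x.
  by move=> /hasP[y /ss' ys h]; apply/hasP; exists y.
split.
  suff: size [:: u, v & filter (B s') s'] <= size (filter (B s) s).
    by rewrite /= !size_filter; rewrite /B in cs *; lia.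
  apply: uniq_leq_size.
    rewrite /= !inE !mem_filter !inE (negPf uv) !eqxx !orbT !andbF /=.
    by rewrite !filter_uniq.
  move=> x; rewrite !inE mem_filter => /or3P[/eqP->|/eqP->|/andP[/BB h /ss' h']].
  - by rewrite mem_filter us' andbT; apply/hasP; exists v; rewrite // eq_sym uv sym_e.
  - by rewrite mem_filter vs andbT; apply/hasP; exists u; rewrite // uv.
  - by rewrite mem_filter h h'.
move=> x xs Bx; case: ifP => [/andP[xs' Bx']|nx].
  by have [zx ?] := zP _ xs' Bx'; rewrite inE zx orbT.
split; first by rewrite mem_head.
have [xs'|] := boolP (x \in s'); last first.
  by rewrite mem_filter xs andbT negbK !inE => /orP[]/eqP->;
    exists v; rewrite ?refl_e // sym_e.
case/hasP: Bx => y ys /andP[yx exy].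
have : y \notin s'.
  apply: contraFN nx => ys'; rewrite xs'; apply/hasP; exists y => //.
  by rewrite yx.
rewrite mem_filter ys andbT negbK !inE => /orP[]/eqP ey; exists y => //.
  by rewrite ey sym_e.
by rewrite ey refl_e.
Qed.

End Counting.

(** * Condition (star) and closed walks *)

Section StarWalks.
Variable G : groupType.
Local Open Scope group_scope.

Lemma prod_telescope (v : nat -> G) m :
  \prod_(1 <= i < m.+1) (v i.-1 * (v i)^-1) = v 0%N * (v m)^-1.
Proof.
elim: m => [|m IH]; first by rewrite big_nil mulgV.
by rewrite big_nat_recr //= IH mulgA mulgVK.
Qed.

(** Conjugating the steps back by [a (k i)] gives factors [v i * (v i.+1)^-1], whose product
    telescopes. Were the walk closed, (star) would force two consecutive colours to agree. *)
Lemma star_walk (W : seq G) : condition_star G ->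
  exists a : 'I_3 -> G, forall (v : nat -> G) (k : nat -> 'I_3) m, (0 < m)%N ->
    (forall i, (i < m)%N ->
       a (k i) * (v i * (v i.+1)^-1) * (a (k i))^-1 \in W /\ v i <> v i.+1) ->
    (forall i, (i.+1 < m)%N -> k i <> k i.+1) -> v 0%N <> v m.
Proof.
move=> star; have [|a [b [c [[ab ac bc] abcP]]]] := star ([fset g in W] `\ 1)%fset.
  by rewrite in_fsetD1 eqxx.
pose t := [tuple a; b; c].
have t_inj : injective (tnth t) by apply/tuple_uniqP; rewrite /= !inE negb_or ab ac bc.
exists (tnth t) => v k m m0 vP kP e.
pose x i := tnth t (k i.-1).
pose g i := x i * (v i.-1 * (v i)^-1) * (x i)^-1.
have [|i||i [/andP[i1 im]]] := abcP m g x m0.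
- move=> [|i] // /andP[_ /vP[gW ne]]; rewrite in_fsetD1 in_fset /= gW andbT.
  apply/eqP => /(congr1 (fun g => (x i.+1)^-1 * g * x i.+1)).
  rewrite /g !mulgA mulVg mul1g mulgVK mulg1 mulVg => /(congr1 (fun g => g * v i.+1)).
  by rewrite mulgVK mul1g.
- by move=> _; apply: mem_tnth.
- under eq_bigr => i _ do rewrite /g !mulgA mulVg mul1g mulgVK.
  by rewrite prod_telescope e mulgV.
- case: i i1 im => // i _ im; rewrite /x => /t_inj /kP; apply; lia.
Qed.

End StarWalks.

(** * The group ring *)

Section Coefficients.
Variables (R : nzRingType) (G : groupType).
Local Notation RG := (group_ring R G).
Implicit Types (f g : RG) (a b x y z : G).
Local Open Scope ring_scope.

Definition gr_elem x : RG := gr_single 1 x.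

Definition gcoef f x : R := mcoeff x f.

Lemma gr_ext f g : (forall z, gcoef f z = gcoef g z) -> f = g.
Proof. by move=> h; apply/malgP. Qed.

Lemma mem_msupp f x : (x \in msupp f) = (gcoef f x != 0).
Proof. by rewrite -mcoeff_neq0. Qed.

Lemma gcoef0 z : gcoef 0 z = 0.
Proof. exact: mcoeff0. Qed.

Lemma gr_neq0P f : f != 0 -> exists x, x \in msupp f.
Proof.
have [e|/fset0Pn[x ?]] := eqVneq (msupp f) fset0; last by exists x.
move/eqP; case; apply: gr_ext => z; rewrite gcoef0; apply/eqP.
by rewrite -[_ == 0]negbK -mem_msupp e.
Qed.

Lemma gr_sum_coef f : f = \sum_(x <- msupp f) gr_single (gcoef f x) x.
Proof. exact: gr_sumE. Qed.

Lemma gcoefD f g z : gcoef (f + g) z = gcoef f z + gcoef g z.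
Proof. exact: mcoeffD. Qed.

Lemma gcoefN f z : gcoef (- f) z = - gcoef f z.
Proof. exact: mcoeffN. Qed.

Lemma gcoef_sum (I : Type) (s : seq I) (F : I -> RG) z :
  gcoef (\sum_(i <- s) F i) z = \sum_(i <- s) gcoef (F i) z.
Proof. exact: (big_morph (gcoef^~ z) (fun f g => gcoefD f g z) (gcoef0 z)). Qed.

Lemma gcoef_single c x z : gcoef (gr_single c x) z = c *+ (x == z).
Proof. exact: mcoeffU. Qed.

Lemma gr_singleM (c d : R) x y :
  (gr_single c x : RG) * gr_single d y = gr_single (c * d) (x * y)%g.
Proof. exact: gr_mul_single. Qed.

Lemma gcoef_mulJ f a g z : gcoef (f * gr_elem a * g) z =
  \sum_(x <- msupp f) \sum_(y <- msupp g)
    gcoef f x * gcoef g y *+ ((x * a * y)%g == z).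
Proof.
rewrite {1}(gr_sum_coef f) {1}(gr_sum_coef g) [X in X * _]mulr_suml mulr_suml gcoef_sum.
apply: eq_bigr => x _.
rewrite mulr_sumr gcoef_sum; apply: eq_bigr => y _.
by rewrite !gr_singleM mulr1 gcoef_single.
Qed.

Lemma gcoef_msupp f z : gcoef f z = \sum_(x <- msupp f) gcoef f x *+ (x == z).
Proof.
by rewrite {1}(gr_sum_coef f) gcoef_sum; apply: eq_bigr => x _; rewrite gcoef_single.
Qed.

(** No other product falls on [u * a * v], so nothing is added or cancelled there. If [u] or [v]
    lies outside its support, both sides are 0. *)
Lemma gcoef_mulJ_unique f a g u v :
  (forall x y, x \in msupp f -> y \in msupp g ->
     (x * a * y = u * a * v)%g -> x = u /\ y = v) ->
  gcoef (f * gr_elem a * g) (u * a * v)%g = gcoef f u * gcoef g v.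
Proof.
move=> uniq_uv; rewrite gcoef_mulJ (gcoef_msupp f u) (gcoef_msupp g v) mulr_suml.
rewrite big_seq [RHS]big_seq; apply: eq_bigr => x xf.
rewrite mulr_sumr big_seq [RHS]big_seq; apply: eq_bigr => y yg.
have [e|ne] := eqVneq (x * a * y)%g (u * a * v)%g.
  by have [-> ->] := uniq_uv _ _ xf yg e; rewrite !eqxx.
have [exu|_] := eqVneq x u; last by rewrite mul0r.
have [eyv|_] := eqVneq y v; last by rewrite mulr0.
by rewrite exu eyv eqxx in ne.
Qed.

Lemma gr_elem1 : gr_elem 1%g = 1.
Proof. by []. Qed.

Lemma gcoef_elemM a f z : gcoef (gr_elem a * f) z = gcoef f (a^-1 * z)%g.
Proof.
rewrite [in RHS](gr_sum_coef f) {1}(gr_sum_coef f) mulr_sumr !gcoef_sum.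
apply: eq_bigr => x _; rewrite gr_singleM mul1r !gcoef_single.
by congr (_ *+ nat_of_bool _); apply/eqP/eqP => [<-|->]; rewrite ?mulKg ?mulVKg.
Qed.

End Coefficients.

(** * Supports of the products [f a_k g] *)

Section Conjugates.
Variables (R : nzRingType) (G : groupType).
Hypothesis dom : is_domain R.
Local Notation RG := (group_ring R G).
Local Open Scope ring_scope.

(* In [f a_k g] the products [x a_k v], [x] in the support of [f], can cancel only for
   those [v] in the support [s] of [g] which are joined to another element of [s] by an
   edge of colour [k]. Packing these [v] into blocks makes every colour class a disjoint
   union of blocks of size at least 2 on average; no closed walk changes colour at each
   step, so points and blocks form a forest and, on average, a point has at most two of
   the three colours. *)
Lemma size_msupp_conj (f : RG) : condition_star G -> f != 0 ->
  exists a : 'I_3 -> G, forall g : RG,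
    (size (msupp g) <= \sum_(k < 3) size (msupp (f * gr_elem R (a k) * g)%R))%N.
Proof.
move=> star f0; have [x0 x0f] := gr_neq0P f0.
(* An equality [x a_k v = y a_k u] with [x], [y] in the support of [f] puts [a_k (u v^-1) a_k^-1]
   into [W]. Points of one block are within two such edges of its centre, so a step between them
   gives a product of four elements of [W]. *)
pose W := [seq (x^-1 * y)%g | x <- msupp f, y <- msupp f].
pose W2 := [seq (u * v)%g | u <- W, v <- W].
have [a aP] := star_walk [seq (u * v)%g | u <- W2, v <- W2] star.
exists a => g; pose s : seq G := msupp g.
have us : uniq s by apply: fset_uniq.
pose e k u v := (a k * (u * v^-1) * (a k)^-1)%g \in W.
have WV w : w \in W -> w^-1%g \in W.
  move=> /allpairsP[[x y] /= [xf yf ->]]; rewrite invgM invgK.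
  exact: (allpairs_f (fun x y => x^-1 * y)%g).
have refl_e k : reflexive (e k).
  move=> u; rewrite /e mulgV mulg1 mulgV -(mulVg x0).
  exact: (allpairs_f (fun x y => x^-1 * y)%g).
have sym_e k : symmetric (e k).
  by move=> u v; apply/idP/idP => /WV; rewrite /e !invgM !invgK !mulgA.
pose B k v := has (fun u => (u != v) && e k v u) s.
have pack k := packing (refl_e k) (sym_e k) us.
have [c /choice[z cz]] := choice pack.
have e2 k u v w1 w2 w : e k u w1 -> e k w1 w -> e k v w2 -> e k w2 w ->
    (a k * (u * v^-1) * (a k)^-1)%g \in [seq (u * v)%g | u <- W2, v <- W2].
  rewrite /e => h1 h2 /WV h3 /WV h4.
  have -> : (a k * (u * v^-1) * (a k)^-1 =
      ((a k * (u * w1^-1) * (a k)^-1) * (a k * (w1 * w^-1) * (a k)^-1)) *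
      ((a k * (w2 * w^-1) * (a k)^-1)^-1 * (a k * (v * w2^-1) * (a k)^-1)^-1))%g.
    by rewrite !invgM !invgK !mulgA !mulgVK.
  by rewrite !allpairs_f.
(* Incidences: [(k, v)] joins the point [v] to its block of colour [k], which has centre [z k v]. *)
pose es := [seq (k, v) | k <- enum 'I_3, v <- filter (B k) s].
have es_uniq : uniq es.
  apply: allpairs_uniq_dep; rewrite ?enum_uniq //.
  - by move=> k _; apply: filter_uniq.
  - by move=> [k v] [k' v'] _ _ /= [-> ->].
have mem_es k v : ((k, v) \in es) = (v \in s) && B k v.
  apply/allpairsPdep/idP => [[k' [v' [_]]]|/andP[vs Bv]].
    by rewrite mem_filter => /andP[? ?] [-> ->]; apply/andP.
  by exists k, v; rewrite mem_enum mem_filter Bv vs.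
have size_es : size es = \sum_(k < 3) count (B k) s.
  rewrite size_allpairs_dep sumnE big_map big_enum /=.
  by apply: eq_bigr => k _; rewrite size_filter.
have forest : (size es <= size s + \sum_(k < 3) size (c k))%N.
  pose qs := [seq (k, y) | k <- enum 'I_3, y <- c k].
  have -> : \sum_(k < 3) size (c k) = size qs.
    by rewrite size_allpairs_dep sumnE big_map big_enum.
  apply: (@forest_size _ _ _ snd (fun i => (i.1, z i.1 i.2))) => //.
  - move=> es' sub es'0; apply: contrapT => no_leaf.
    have mate_p i : i \in es' -> exists2 i1, i1 \in es' & i1.2 = i.2 /\ i1 <> i.
      move=> ies; apply: contrapT => no; apply: no_leaf; exists i => //; left.
      by move=> i1 i1s p1; apply: contrapT => n1; apply: no; exists i1.
    have mate_q i : i \in es' -> exists2 i1, i1 \in es' &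
        [/\ i1.1 = i.1, z i.1 i1.2 = z i.1 i.2 & i1 <> i].
      move=> ies; apply: contrapT => no; apply: no_leaf; exists i => //; right.
      move=> i1 i1s /= [q1 q2]; apply: contrapT => n1; apply: no; exists i1 => //.
      by split=> //; rewrite -{1}q1.
    (* Without a leaf one can always move on: to another point of the same block, and there to
       another colour. *)
    have /choice[next nextP] : forall i, exists i', i \in es' ->
        [/\ i' \in es' /\ (i.1, i'.2) \in es', i'.1 <> i.1, i'.2 <> i.2
          & z i.1 i'.2 = z i.1 i.2].
      move=> i; case: (boolP (i \in es')) => [ies|]; last by exists i.
      have [[k1 v1] i1s [/= e1 zz n1]] := mate_q _ ies.
      have [[k2 v2] i2s [/= e2' n2]] := mate_p _ i1s.
      case: i ies e1 zz n1 => k v /= _ e1 zz n1; subst k1 v2.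
      exists (k2, v1) => _; split=> //= [ek|ev]; first by apply: n2; rewrite ek.
      by apply: n1; rewrite ev.
    case: es' es'0 sub no_leaf nextP {mate_p mate_q} => // i0 es' _ sub _ nextP.
    pose w n := iter n next i0.
    have w_es n : w n \in i0 :: es'.
      by elim: n => [|n IH]; [apply: mem_head | have [[]] := nextP _ IH].
    (* By the pigeonhole principle the walk returns to an earlier incidence; such a closed walk
       contradicts [aP]. *)
    have [i [j [ij eij]]] : exists i j, (i < j)%N /\ w i = w j.
      have : ~~ uniq (mkseq w (size (i0 :: es')).+1).
        have w_sub : {subset mkseq w (size (i0 :: es')).+1 <= i0 :: es'}.
          by move=> _ /mapP[n _ ->].
        by apply/negP => /uniq_leq_size => /(_ _ w_sub); rewrite size_mkseq ltnn.
      case/(uniqPn i0) => i [j [ij]]; rewrite size_mkseq => js.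
      by rewrite !nth_mkseq ?(ltn_trans ij) // => e_ij; exists i, j.
    have step n : [/\ ((w n).1, (w n.+1).2) \in es, (w n.+1).1 <> (w n).1,
        (w n.+1).2 <> (w n).2 & z (w n).1 (w n.+1).2 = z (w n).1 (w n).2].
      by have [[_ /sub]] := nextP _ (w_es n).
    apply: (aP (fun t => (w (i + t)%N).2) (fun t => (w (i + t)%N).1) (j - i)%N).
    + by rewrite subn_gt0.
    + move=> t _; rewrite addnS; have [es_v' _ n2 zz] := step (i + t)%N.
      split; last by move/esym.
      have := sub _ (w_es (i + t)%N).
      case: (w (i + t)%N) (w (i + t).+1) zz es_v' {n2} => k v [k' v'] /= zz.
      rewrite !mem_es => /andP[vs' Bv'] /andP[vs Bv].
      have [_ [w1 h1 h2]] := (cz k).2 v vs Bv.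
      have [_ [w2 h3 h4]] := (cz k).2 v' vs' Bv'.
      by apply: e2 h1 h2 h3 _; rewrite -zz.
    + by move=> t _; rewrite addnS; have [_ n1 _ _] := step (i + t)%N; move/esym.
    + by rewrite addn0 subnKC ?eij // ltnW.
  - by move=> [k v]; rewrite mem_es => /andP[].
  - move=> [k v]; rewrite mem_es => /andP[vs Bv] /=.
    by have [zc _] := (cz k).2 v vs Bv; apply/allpairsPdep; exists k, (z k v);
      rewrite mem_enum.
(* A point [v] isolated in colour [k] leaves [x0 a_k v] in the support, since [R] has no zero
   divisors. *)
have free k : (size s - count (B k) s <= size (msupp (f * gr_elem R (a k) * g)%R))%N.
  have -> : (size s - count (B k) s)%N =
      size [seq (x0 * a k * v)%g | v <- filter (predC (B k)) s].
    by rewrite size_map size_filter -(count_predC (B k) s) addKn.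
  apply: uniq_leq_size.
    by rewrite map_inj_uniq ?filter_uniq //; apply: mulgI.
  move=> _ /mapP[v + ->]; rewrite mem_filter => /andP[/= nB vs].
  rewrite mem_msupp gcoef_mulJ_unique.
    by apply/eqP => /dom /orP[]; apply/negP; rewrite -mem_msupp.
  move=> x y xf ys e_xy; suff yv : y = v by move: e_xy; rewrite yv => /mulIg/mulIg.
  apply/eqP; apply: contraNT nB => yv; apply/hasP; exists y; rewrite // yv /=.
  rewrite /e; apply/allpairsP; exists (x0, x); split=> //=.
  by apply: (mulgI x0); rewrite mulVKg !mulgA -e_xy !mulgK.
have le k : (count (B k) s <= size s)%N := count_size _ _.
have h1 : (\sum_(k < 3) (size s - count (B k) s) <=
    \sum_(k < 3) size (msupp (f * gr_elem R (a k) * g)%R))%N.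
  by apply: leq_sum => k _; exact: free.
have h2 : (\sum_(k < 3) (size s - count (B k) s) + size es = 3 * size s)%N.
  rewrite size_es -big_split /=; under eq_bigr => k _ do rewrite subnK //.
  by rewrite sum_nat_const card_ord.
have h3 : (2 * (\sum_(k < 3) size (c k)) <= size es)%N.
  by rewrite size_es big_distrr; apply: leq_sum => k _; exact: (cz k).1.
(* Here [t] counts points, [p] incidences, [q] blocks and [r] isolated pairs of a point and a
   colour. The first and last bounds give [p <= 2 t], whence [r = 3 t - p >= t]. *)
have arith (p q r t : nat) : (p <= t + q)%N -> (r + p = 3 * t)%N -> (2 * q <= p)%N ->
    (t <= r)%N by lia.
exact: leq_trans (arith _ _ _ _ forest h2 h3) h1.
Qed.
End Conjugates.

(** * Right ideals and primitivity *)

Section RightIdeals.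
Variable S : nzRingType.
Local Open Scope ring_scope.

Record rideal := RIdeal {
  rset : set S;
  rideal0 : rset 0;
  ridealD : forall u v, rset u -> rset v -> rset (u + v);
  ridealM : forall u a, rset u -> rset (u * a) }.

Section Quotient.
Variable I : rideal.

Definition rideal_pred : pred S := fun u => u \in rset I.

Fact rideal_zmod_closed : zmod_closed rideal_pred.
Proof.
split=> [|u v]; rewrite /rideal_pred /in_mem /= !in_setE; first exact: rideal0.
by move=> Iu Iv; apply: ridealD => //; rewrite -mulrN1; apply: ridealM.
Qed.

HB.instance Definition _ := GRing.isZmodClosed.Build S rideal_pred rideal_zmod_closed.

Let rideal_closed : zmodClosed S := GRing.ZmodClosed.clone S rideal_pred _.
Definition rquot : Type := Quotient.quot rideal_closed.
HB.instance Definition _ := GRing.Zmodule.on rquot.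

Definition rpi (u : S) : rquot := \pi_(Quotient.quot rideal_closed) u.
Definition rrepr (q : rquot) : S := repr (q : Quotient.quot rideal_closed).

Lemma rpiK q : rpi (rrepr q) = q.
Proof. exact: reprK. Qed.

Lemma rpi_eq u v : rpi u = rpi v <-> rset I (u - v).
Proof.
have e : (u - v \in rset I) = (rpi u == rpi v) := Quotient.idealrBE rideal_closed u v.
by split=> [/eqP|h]; [|apply/eqP]; rewrite -e in_setE.
Qed.

Lemma rpiD u v : rpi (u + v) = rpi u + rpi v.
Proof. exact: raddfD. Qed.

Lemma rpi_eq0 u : rpi u = 0 <-> rset I u.
Proof. by rewrite -[0](raddf0 (\pi_(Quotient.quot rideal_closed))) rpi_eq subr0. Qed.

Definition rquot_scale (a : S^c) (q : rquot) : rquot := rpi (rrepr q * (a : S)).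

Lemma rquot_scale_pi (a : S^c) u : rquot_scale a (rpi u) = rpi (u * (a : S)).
Proof. by apply/rpi_eq; rewrite -mulrBl; apply: ridealM; apply/rpi_eq/rpiK. Qed.

Fact rquot_scaleA a b q : rquot_scale a (rquot_scale b q) = rquot_scale (a * b) q.
Proof. by rewrite -(rpiK q) !rquot_scale_pi -mulrA. Qed.

Fact rquot_scale1 : left_id 1 rquot_scale.
Proof. by move=> q; rewrite -(rpiK q) rquot_scale_pi mulr1. Qed.

Fact rquot_scaleDr : right_distributive rquot_scale +%R.
Proof.
by move=> a p q; rewrite -(rpiK q) -(rpiK p) -rpiD !rquot_scale_pi mulrDl rpiD.
Qed.

Fact rquot_scaleDl q : {morph rquot_scale^~ q : a b / a + b}.
Proof. by move=> a b; rewrite -(rpiK q) !rquot_scale_pi mulrDr rpiD. Qed.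

HB.instance Definition _ := GRing.Zmodule_isLmodule.Build S^c rquot
  rquot_scaleA rquot_scale1 rquot_scaleDr rquot_scaleDl.

Lemma rquotZ (a : S^c) u : a *: rpi u = rpi (u * (a : S)).
Proof. exact: rquot_scale_pi. Qed.

End Quotient.

(** The preimage of a submodule is a right ideal above [I]; by maximality it equals [I] or contains
    1. *)
Lemma rquot_irreducible (I : rideal) : ~ rset I 1 ->
  (forall J, rset I `<=` rset J -> ~ rset J 1 -> rset J `<=` rset I) ->
  irreducible_module (rquot I : lmodType S^c).
Proof.
move=> I1 Imax; split.
  by exists (rpi I 1); apply/eqP => /rpi_eq0.
move=> N [N0 Nlin].
pose J0 : set S := [set u | rpi I u \in mem N].
have J00 : J0 0 by rewrite /J0 /= (rpi_eq0 I 0).2 //; apply: rideal0.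
have JD u v : J0 u -> J0 v -> J0 (u + v).
  move=> Ju Jv; have := Nlin 1 _ _ Ju Jv.
  by rewrite /J0 /= scale1r rpiD.
have JM u a : J0 u -> J0 (u * a).
  move=> Ju; have := Nlin a _ _ Ju N0.
  by rewrite addr0 rquotZ.
pose J := RIdeal J00 JD JM.
have NJ q : N q -> rset J (rrepr q) by rewrite /= /J0 /= rpiK => ?; apply: mem_set.
have [J1|/Imax] := EM (rset J 1).
  right; apply/seteqP; split=> // q _.
  by apply: set_mem; rewrite -(rpiK q) -[rrepr q]mul1r; apply: (JM).
move=> sub; left; apply/seteqP; split=> q.
  move=> /NJ Jq; rewrite -(rpiK q); apply/rpi_eq0.
  by apply: sub Jq => u Iu; rewrite /= /J0 /= (rpi_eq0 I u).2.
by move=> ->; apply: set_mem.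
Qed.

Lemma exists_maximal_rideal (I : rideal) : ~ rset I 1 ->
  exists2 M, rset I `<=` rset M &
    ~ rset M 1 /\ forall J, rset M `<=` rset J -> ~ rset J 1 -> rset J `<=` rset M.
Proof.
move=> I1.
pose P (A : set S) := A = set0 \/
  exists M, [/\ A = rset M, rset I `<=` rset M & ~ rset M 1].
have [|A [PA Amax]] := @Zorn_bigcup S P.
  move=> F FP Ftot.
  have [[A0 FA0 [u0 A0u]]|noA] := EM (exists2 A, F A & A !=set0); last first.
    left; apply/seteqP; split=> // u [A FA Au]; case: noA.
    by exists A => //; exists u.
  have FI A u : F A -> A u -> exists M, [/\ A = rset M, rset I `<=` rset M & ~ rset M 1].
    by move=> FA Au; case: (FP _ FA) => // A_0; rewrite A_0 in Au.
  have [M0 [eM0 IM0 _]] := FI _ _ FA0 A0u.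
  pose U := \bigcup_(X in F) X.
  have U0 : U 0 by exists A0 => //; rewrite eM0; apply: rideal0.
  have UD u v : U u -> U v -> U (u + v).
    move=> [A FA Au] [B FB Bv].
    have [AB|BA] := Ftot _ _ FA FB.
      exists B => //; have [M [eM _ _]] := FI _ _ FB Bv.
      by rewrite eM; apply: ridealD; rewrite -eM //; apply: AB.
    exists A => //; have [M [eM _ _]] := FI _ _ FA Au.
    by rewrite eM; apply: ridealD; rewrite -eM //; apply: BA.
  have UM u a : U u -> U (u * a).
    move=> [A FA Au]; exists A => //; have [M [eM _ _]] := FI _ _ FA Au.
    by rewrite eM; apply: ridealM; rewrite -eM.
  right; exists (RIdeal U0 UD UM); split=> //.
    by move=> u /IM0 Mu; exists A0; rewrite // eM0.
  by move=> [A FA A1]; have [M [eM _]] := FI _ _ FA A1; apply; rewrite -eM.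
case: PA => [A_0|[M [eM IM M1]]].
  have PI : P (rset I) by right; exists I; split.
  exfalso; apply: (Amax _ _ PI).
  by rewrite A_0; split=> [? []|h]; exact: (h 0 (rideal0 I)).
exists M => //; split=> // J MJ J1 u Ju; apply: contrapT => Mu.
have PJ : P (rset J) by right; exists J; split=> // v /IM /MJ.
apply: (Amax _ _ PJ).
by rewrite eM; split=> // h; apply: Mu; apply: h.
Qed.

(** Let [M] be a maximal right ideal above [I]. The annihilator of [S/M] is a two-sided ideal inside
    [M]; if nonzero, it would contain some [u] with [u + 1] in [I], and 1 would lie in [M]. *)
Lemma right_primitive_comaximal (I : rideal) : ~ rset I 1 ->
  (forall J : set S, J 0 -> (forall u v, J u -> J v -> J (u + v)) ->
     (forall a u, J u -> J (a * u)) -> (forall u a, J u -> J (u * a)) ->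
     (exists2 u, J u & u != 0) -> exists2 u, J u & rset I (u + 1)) ->
  right_primitive S.
Proof.
move=> I1 comax; have [M IM [M1 Mmax]] := exists_maximal_rideal I1.
exists (rquot M : lmodType S^c); split; last exact: rquot_irreducible.
move=> a ann; apply: contrapT => /eqP a0.
pose J : set S := [set u | forall v, rset M (v * u)].
have [|u v|b u|u b||u Ju Iu] := comax J.
- by move=> v; rewrite mulr0; apply: rideal0.
- by move=> Ju Jv w; rewrite mulrDr; apply: ridealD.
- by move=> Ju w; rewrite mulrA.
- by move=> Ju w; rewrite mulrA; apply: ridealM.
- exists a => // v; have := ann (rpi M v).
  by rewrite rquotZ => /rpi_eq0.
- apply: M1; have := ridealD (IM _ Iu) (ridealM (-1) (Ju 1)).
  by rewrite mul1r mulrN1 addrAC subrr add0r.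
Qed.

End RightIdeals.

(** * The right ideal of the theorem *)

Section Properness.
Variables (R : nzRingType) (G : groupType).
Local Notation RG := (group_ring R G).
Variables (a : RG -> 'I_3 -> G) (l : RG -> 'I_3 -> 'I_5 -> G).
Local Open Scope ring_scope.

Definition eps (f : RG) : RG :=
  \sum_(i : 'I_3 * 'I_5) gr_elem R (l f i.1 i.2) * (f * gr_elem R (a f i.1)).

(** This is the count of the proof idea: [few_stars] is applied to the triples [(f, k, h)] with [h]
    in the support of [f a_k r_f]. *)
Lemma eps_comaximal_proper (A : RG -> 'I_3 -> 'I_5 -> G -> bool)
    (fs : seq RG) (r : RG -> RG) : uniq fs ->
  (forall f, f \in fs -> forall g : RG,
     (size (msupp g) <= \sum_(k < 3) size (msupp (f * gr_elem R (a f k) * g)%R))%N) ->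
  (forall f k j f' k' j' v, f \in fs -> f' \in fs -> A f k j v -> A f' k' j' v ->
     (f, k, j) = (f', k', j')) ->
  (forall f k j f' k' j' h, f \in fs -> f' \in fs ->
     ~~ A f k j (l f k j * h)%g -> ~~ A f' k' j' (l f' k' j' * h)%g ->
     (f, k, j) = (f', k', j')) ->
  \sum_(f <- fs) (eps f + 1) * r f <> 1.
Proof.
move=> ufs big_supp disjA pushA sum1.
pose supp f k : seq G := msupp (f * gr_elem R (a f k) * r f).
pose X := [seq (p, h) | p <- [seq (f, k) | f <- fs, k <- enum 'I_3], h <- supp p.1 p.2].
(* Outside [V0] a translate can be cancelled only by another translate. *)
pose V0 : seq G := 1%g :: flatten [seq (msupp (r f) : seq G) | f <- fs].
pose F (t : RG * 'I_3 * G) j : G := (l t.1.1 t.1.2 j * t.2)%g.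
pose ok (t : RG * 'I_3 * G) j := A t.1.1 t.1.2 j (F t j).
have uX : uniq X.
  apply: allpairs_uniq_dep.
  - by apply: allpairs_uniq; rewrite ?enum_uniq // => -[? ?] [? ?].
  - by move=> p _; apply: fset_uniq.
  - by move=> [p h] [p' h'] _ _ /= [-> ->].
have mem_X f k h : ((f, k, h) \in X) = (f \in fs) && (h \in supp f k).
  apply/allpairsPdep/andP => [[[f' k'] [h' [pfs hs [-> -> ->]]]]|[ff hs]].
    by split=> //; case/allpairsP: pfs => -[? ?] [? _ [-> _]].
  exists (f, k), h; split=> //; apply/allpairsP; exists (f, k).
  by split; rewrite ?mem_enum.
have size_X : size X = \sum_(f <- fs) \sum_(k < 3) size (supp f k).
  rewrite size_allpairs_dep sumnE big_map big_allpairs_dep.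
  by apply: eq_bigr => f _; rewrite big_enum.
have size_V0 : size V0 = (\sum_(f <- fs) size (msupp (r f))).+1.
  by rewrite /= size_flatten /shape -map_comp sumnE big_map.
have le_X : (\sum_(f <- fs) size (msupp (r f)) <= size X)%N.
  rewrite size_X big_seq [leqRHS]big_seq; apply: leq_sum => f ff; exact: big_supp.
have few : (3 * size X <= size V0)%N.
  apply: (@few_stars _ _ F ok) => //.
  - move=> [[f k] h] i j; rewrite mem_X => /andP[ff _] ni nj.
    by have [] := pushA _ _ _ _ _ _ _ ff ff ni nj.
  - move=> [[f k] h] i [[f' k'] h'] j; rewrite !mem_X => /andP[ff _] /andP[ff' _].
    rewrite /ok /F /= => oki okj e; rewrite -e in okj.
    have [ef ek ej] := disjA _ _ _ _ _ _ _ ff ff' oki okj.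
    by move: e; rewrite -ef -ek -ej => /mulgI ->.
  (* If nothing else hit [v], the left-hand side would have at [v] the nonzero coefficient of
     [f a_k r_f] at [h], but 1 has coefficient 0 there. *)
  - move=> [[f k] h] j tX; set v := F _ _ => vV0.
    apply: contrapT => no.
    have other f' i : f' \in fs -> (f', i) <> (f, (k, j)) ->
        gcoef (f' * gr_elem R (a f' i.1) * r f') ((l f' i.1 i.2)^-1 * v)%g = 0.
      move=> ff' ne; apply/eqP; apply: contrapT => /negP; rewrite -mem_msupp => hs.
      apply: no; exists (f', i.1, (l f' i.1 i.2)^-1 * v)%g, i.2; split.
      + by rewrite mem_X ff'.
      + by move=> [ef ek _ ej]; apply: ne; rewrite ef -ek -ej; case: (i).
      + by rewrite /F /= mulVKg.
    have /= := congr1 (fun g : RG => gcoef g v) sum1.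
    have vr f' : f' \in fs -> gcoef (r f') v = 0.
      move=> ff'; apply/eqP; apply: contraNT vV0; rewrite -mem_msupp => vs.
      by rewrite inE; apply/orP; right; apply/flatten_mapP; exists f'.
    have [ff hs] : f \in fs /\ h \in supp f k by move: tX; rewrite mem_X => /andP.
    have v1 : (1%g == v) = false.
      by apply/negP => /eqP v1; move: vV0; rewrite inE v1 eqxx.
    rewrite -[1 in RHS]gr_elem1 gcoef_single v1 mulr0n gcoef_sum.
    rewrite big_seq (eq_bigr (fun f' => \sum_(i : 'I_3 * 'I_5)
        gcoef (f' * gr_elem R (a f' i.1) * r f') ((l f' i.1 i.2)^-1 * v)%g)); last first.
      move=> f' ff'; rewrite mulrDl mul1r gcoefD (vr _ ff') addr0 mulr_suml gcoef_sum.
      by apply: eq_bigr => i _; rewrite -mulrA gcoef_elemM.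
    rewrite -big_seq (bigD1_seq f) //= (bigD1 (k, j)) //= /v /F /= mulKg.
    rewrite big1 ?addr0 => [|i ik]; last first.
      by apply: other => // -[ei]; rewrite ei eqxx in ik.
    rewrite big_seq_cond big1 ?addr0 => [|f' /andP[ff' nf]]; last first.
      by apply: big1 => i _; apply: other => // -[ef _]; rewrite ef eqxx in nf.
    by apply/eqP; rewrite -mem_msupp.
have X0 : size X = 0%N by move: few; rewrite size_V0; lia.
have r0 f : f \in fs -> r f = 0.
  move=> ff; apply/eqP; apply: contraT => /gr_neq0P[h hs].
  move: le_X; rewrite X0 leqn0 sum_nat_seq_eq0 => /allP/(_ _ ff)/= /nilP e.
  by have : h \in enum_fset (msupp (r f)) by []; rewrite e.
move/eqP: sum1; rewrite big_seq big1 ?(eq_sym 0) ?oner_eq0 // => f ff.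
by rewrite r0 // mulr0.
Qed.

End Properness.

(** * Coding group ring elements and assembling the right ideal *)

Section Assembly.
Local Open Scope ring_scope.

(* [D] is the set of coefficients from which the elements [f] indexing the right
   ideal are formed; only [D], not [R], has to be injected into [nat * G]. *)
Lemma group_ring_primitive (R : nzRingType) (G : groupType) (D : pred R)
    (cR : R -> nat * G) :
  (exists H : set G, [/\ free_subgroup H, nonabelian H & H #= [set: G]]) ->
  condition_star G -> is_domain R -> {in D &, injective cR} ->
  (forall J : set (group_ring R G), J 0 ->
     (forall u v, J u -> J v -> J (u + v)) ->
     (forall a u, J u -> J (a * u)) -> (forall u a, J u -> J (u * a)) ->
     (exists2 u, J u & u != 0) ->
     exists2 f, J f & f != 0 /\ forall z, gcoef f z \in D) ->
  right_primitive (group_ring R G).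
Proof.
move=> [H [freeH nabH cardH]] star dom cR_inj small_elt.
pose RG := group_ring R G.
have [T [x [y [code [L [A [xy code_inj disjA pushA]]]]]]] :=
  free_pingpong freeH nabH cardH.
pose lc := lcode x y; have lc_inj : injective lc := lcode_inj xy.
(* A coefficient is coded through [cR], with its natural number written in unary. *)
pose term (p : R * G) := lc [:: nseq (cR p.1).1 x; code (cR p.1).2; code p.2].
pose terms (f : RG) := [seq (gcoef f z, z) | z <- msupp f].
pose idx (f : RG) (k : 'I_3) (j : 'I_5) := lc [:: lc (map term (terms f)); nseq k x; nseq j x].
pose good (f : RG) := f != 0 /\ forall z, gcoef f z \in D.
have nseq_inj n m : nseq n x = nseq m x -> n = m.
  by move=> /(congr1 size); rewrite !size_nseq.
have idx_inj f k j f' k' j' : good f -> good f' -> idx f k j = idx f' k' j' ->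
    (f, k, j) = (f', k', j').
  move=> [_ Df] [_ Df'] /lc_inj[/lc_inj e /nseq_inj/val_inj-> /nseq_inj/val_inj->].
  suff e_terms : terms f = terms f'.
    rewrite [f]gr_sum_coef [f']gr_sum_coef.
    have bigE (g : RG) : \sum_(z <- msupp g) gr_single (gcoef g z) z =
        \sum_(p <- terms g) gr_single p.1 p.2 :> RG by rewrite big_map.
    by rewrite !bigE e_terms.
  have term_inj : {in [pred p : R * G | p.1 \in D] &, injective term}.
    move=> [c z] [c' z']; rewrite !inE /= => Dc Dc' /lc_inj[/nseq_inj e1 /code_inj e2].
    move/code_inj => ->; congr (_, _); apply: cR_inj => //.
    by rewrite [cR c]surjective_pairing e1 e2 -surjective_pairing.
  apply: (inj_in_map term_inj) e; apply/allP => p /mapP[z _ ->]; rewrite inE /=.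
    exact: Df.
  exact: Df'.
have /choice[a aP] : forall f : RG, exists a : 'I_3 -> G, f != 0 -> forall g : RG,
    (size (msupp g) <= \sum_(k < 3) size (msupp (f * gr_elem R (a k) * g)%R))%N.
  move=> f; have [->|/(size_msupp_conj dom star)[a aP]] := eqVneq f 0.
    by exists (fun=> 1%g).
  by exists a.
pose l f k j := L (idx f k j); pose e f : RG := eps a l f + 1.
pose I : set RG := [set u | exists2 ps : seq (RG * RG),
  {in ps, forall p, good p.1} & u = \sum_(p <- ps) e p.1 * p.2].
have I0 : I 0 by exists [::] => //; rewrite big_nil.
have ID u v : I u -> I v -> I (u + v).
  move=> [ps gps ->] [qs gqs ->]; exists (ps ++ qs); last by rewrite big_cat.
  by move=> p; rewrite mem_cat => /orP[/gps|/gqs].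
have IM u b : I u -> I (u * b).
  move=> [ps gps ->]; exists [seq (p.1, p.2 * b) | p <- ps].
    by move=> _ /mapP[p /gps ? ->].
  by rewrite big_map mulr_suml; apply: eq_bigr => p _; rewrite mulrA.
apply: (@right_primitive_comaximal _ (RIdeal I0 ID IM)) => /=.
(* An [f] may occur several times in [ps]; its cofactors are added up into one [r f]. *)
- move=> [ps gps sum1]; pose r f := \sum_(p <- ps | p.1 == f) p.2.
  have gfs f : f \in undup (map fst ps) -> good f.
    by rewrite mem_undup => /mapP[p /gps ? ->].
  have [] := @eps_comaximal_proper R G a l (fun f k j => A (idx f k j))
    (undup (map fst ps)) r.
  + exact: undup_uniq.
  + by move=> f /gfs[f0 _]; apply: aP.
  + move=> f k j f' k' j' v /gfs gf /gfs gf' h1 h2.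
    exact: idx_inj gf gf' (disjA _ _ _ h1 h2).
  + move=> f k j f' k' j' h /gfs gf /gfs gf' h1 h2.
    exact: idx_inj gf gf' (pushA _ _ _ h1 h2).
  rewrite [RHS]sum1 /r; under eq_bigr do rewrite mulr_sumr big_mkcond.
  rewrite exchange_big /= big_seq [RHS]big_seq; apply: eq_bigr => p pps.
  rewrite (bigD1_seq p.1) ?undup_uniq ?mem_undup ?map_f //= eqxx big1 ?addr0 // => f ne.
  by rewrite eq_sym (negPf ne).
- move=> J J0 JD Jl Jr nz; have [f Jf gf] := small_elt J J0 JD Jl Jr nz.
  exists (eps a l f); last first.
    exists [:: (f, 1)]; last by rewrite big_seq1 mulr1.
    by move=> p; rewrite inE => /eqP ->.
  rewrite /eps; apply: (big_ind J) => // i _; apply: Jl; exact: Jr.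
Qed.

End Assembly.

(** * Elements with integral coefficients *)

(** For [x = a b^-1], an equality [s x t = s' x t'] reads [(a^-1 g a) (b^-1 h b) = 1] with
    [g = s'^-1 s] and [h = t t'^-1]. If [g] is nontrivial, so is [h], and this contradicts (star)
    for [m = 2]. *)
Lemma generic_translate (G : groupType) (U : seq G) : condition_star G ->
  exists x : G, {in U & U, forall s t, {in U & U, forall s' t',
    (s * x * t = s' * x * t')%g -> s = s' /\ t = t'}}.
Proof.
pose W := [seq (s^-1 * t)%g | s <- U, t <- U] ++ [seq (s * t^-1)%g | s <- U, t <- U].
move=> star; have [|a [b [c [[ab _ _] abcP]]]] := star ([fset g in W] `\ 1%g)%fset.
  by rewrite in_fsetD1 eqxx.
exists (a * b^-1)%g => s t sU tU s' t' s'U t'U e.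
have [ess'|ns] := eqVneq s s'; first by move: e; rewrite ess' => /mulgI.
pose g := (s'^-1 * s)%g; pose h := (t * t'^-1)%g.
have e1 : (a^-1 * g * a * (b^-1 * h * b) = 1)%g.
  rewrite /g /h; apply: (mulgI (s' * a)%g); apply: (mulIg (b^-1 * t')%g).
  by rewrite mulg1 !mulgA !mulgK mulgV mul1g mulgVK; rewrite !mulgA in e.
have g1 : g != 1%g.
  by apply: contra_neq ns => g1; rewrite -[RHS]mulg1 -g1 mulVKg.
have h1 : h != 1%g.
  apply: contra_neq g1 => h1; move: e1; rewrite h1 mulg1 mulVg mulg1.
  by move=> /(congr1 (fun z => a * z * a^-1)%g); rewrite !mulgA mulgV mul1g mulgK mulg1 mulgV.
have := abcP 2 (fun i => if i == 1%N then g else h) (fun i => if i == 1%N then a else b) isT.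
case.
- move=> [|[|[|i]]] //= _; rewrite in_fsetD1 in_fset /= mem_cat ?g1 ?h1 /=.
    by rewrite (allpairs_f (fun s t => s^-1 * t)%g).
  by rewrite (allpairs_f (fun s t => s * t^-1)%g) // orbT.
- by move=> [|[|[|i]]] //= _; rewrite !inE eqxx ?orbT.
- by rewrite big_nat_recl // big_nat1.
- by move=> [|[|i]] [] // _ /= eab; rewrite eab eqxx in ab.
Qed.

Section IntegralElements.
Variables (K : fieldType) (G : groupType).
Local Notation KG := (group_ring K G).
Implicit Types (f g : KG).
Local Open Scope ring_scope.

(** The image of the integers is at most countable whatever the size of [K], so natural numbers
    suffice to encode it. *)
Definition int_coef : pred K := fun c => `[< exists n : int, c = n%:~R >].

Lemma int_coefP c : reflect (exists n : int, c = n%:~R) (c \in int_coef).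
Proof. exact: asboolP. Qed.

Lemma int_coef_closed : subring_closed int_coef.
Proof.
split=> [|_ _ /int_coefP[n ->] /int_coefP[m ->]|_ _ /int_coefP[n ->] /int_coefP[m ->]];
  apply/int_coefP.
- by exists 1.
- by exists (n - m); rewrite intrB.
- by exists (n * m); rewrite intrM.
Qed.

HB.instance Definition _ := GRing.isSubringClosed.Build K int_coef int_coef_closed.

Lemma int_coef_mulJ f x g :
  (forall z, gcoef f z \in int_coef) -> (forall z, gcoef g z \in int_coef) ->
  forall z, gcoef (f * gr_elem K x * g) z \in int_coef.
Proof.
move=> fi gi z; rewrite gcoef_mulJ; apply: rpred_sum => s _; apply: rpred_sum => t _.
by apply: rpredMn; apply: rpredM.
Qed.

Lemma gr_single_central (c : K) f : gr_single c 1%g * f = f * gr_single c 1%g.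
Proof.
rewrite (gr_sum_coef f) mulr_sumr mulr_suml; apply: eq_bigr => x _.
by rewrite !gr_singleM mul1g mulg1 mulrC.
Qed.

Lemma gcoef_scale (c : K) f z : gcoef (gr_single c 1%g * f) z = c * gcoef f z.
Proof.
rewrite [in LHS](gr_sum_coef f) mulr_sumr gcoef_sum [in RHS]gcoef_msupp mulr_sumr.
by apply: eq_bigr => x _; rewrite gr_singleM mul1g gcoef_single mulrnAr.
Qed.

(** For a generic [x], the coefficients at [s x t] give [f_s g_t = g_s f_t]; then fix [t] in the
    support of [f]. *)
Lemma proportional_of_commutation f g : condition_star G -> f != 0 ->
  (forall x, f * gr_elem K x * g = g * gr_elem K x * f) ->
  exists c, g = gr_single c 1%g * f.
Proof.
move=> star f0 fg.
have [x xP] := generic_translate (msupp f ++ msupp g : seq G) star.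
have fU z : z \in msupp f -> z \in (msupp f ++ msupp g : seq G).
  by rewrite mem_cat => ->.
have gU z : z \in msupp g -> z \in (msupp f ++ msupp g : seq G).
  by rewrite mem_cat orbC => ->.
have [t tf] := gr_neq0P f0; have ft : gcoef f t != 0 by rewrite -mem_msupp.
exists (gcoef g t / gcoef f t); apply: gr_ext => s; rewrite gcoef_scale.
have [sU|] := boolP (s \in (msupp f ++ msupp g : seq G)); last first.
  by rewrite mem_cat negb_or !mem_msupp !negbK => /andP[/eqP -> /eqP ->]; rewrite mulr0.
apply: (mulIf ft); rewrite mulrAC divfK // [RHS]mulrC.
have := congr1 (fun h : KG => gcoef h (s * x * t)%g) (fg x) => /=.
rewrite !gcoef_mulJ_unique // => y z yU zU; apply: xP; auto.
Qed.

(* An element [sum c_i f_i] of the ideal, with [f_i] integral and as few terms as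
   possible: [f x f_1 - f_1 x f] has fewer terms, so it vanishes for every [x], which
   makes [f] proportional to [f_1]. *)
Lemma exists_integral_elt (J : set KG) : condition_star G ->
  J 0 -> (forall u v, J u -> J v -> J (u + v)) ->
  (forall a u, J u -> J (a * u)) -> (forall u a, J u -> J (u * a)) ->
  (exists2 u, J u & u != 0) ->
  exists2 f, J f & f != 0 /\ forall z, gcoef f z \in int_coef.
Proof.
move=> star J0 JD Jl Jr [u Ju u0].
pose comb (ps : seq (K * KG)) : KG := \sum_(p <- ps) gr_single p.1 1%g * p.2.
suff main n : forall ps : seq (K * KG), (size ps <= n)%N ->
    {in ps, forall p z, gcoef p.2 z \in int_coef} -> J (comb ps) -> comb ps != 0 ->
    exists2 f, J f & f != 0 /\ forall z, gcoef f z \in int_coef.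
  (* Group elements are integral, so [u] itself is a combination of the required kind. *)
  have eu : comb [seq (gcoef u z, gr_elem K z) | z <- msupp u] = u.
    rewrite /comb big_map [RHS]gr_sum_coef; apply: eq_bigr => z _.
    by rewrite gr_singleM mulr1 mul1g.
  apply: (main _ [seq (gcoef u z, gr_elem K z) | z <- msupp u] (leqnn _)); rewrite ?eu //.
  move=> _ /mapP[y _ ->] z /=; rewrite gcoef_single; apply: rpredMn; exact: rpred1.
elim: n => [|n IH] [|[c g] ps] //= le int_ps Jf f0; try by rewrite /comb big_nil eqxx in f0.
have gi : forall z, gcoef g z \in int_coef by apply: (int_ps (c, g)); rewrite mem_head.
have int_ps' : {in ps, forall p z, gcoef p.2 z \in int_coef}.
  by move=> p pps; apply: int_ps; rewrite inE pps orbT.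
have comb_cons : comb ((c, g) :: ps) = gr_single c 1%g * g + comb ps.
  by rewrite /comb big_cons.
have [g0|g0] := eqVneq g 0.
  by apply: (IH ps) => //; move: Jf f0; rewrite comb_cons g0 mulr0 add0r.
set f := comb _ in Jf f0 comb_cons.
have [[x nx]|all_x] := EM (exists x, f * gr_elem K x * g != g * gr_elem K x * f).
  (* [br] is additive, commutes with the central scalars and kills [g], so the first term of [f]
     drops out; it also preserves integrality. *)
  pose br (h : KG) := h * gr_elem K x * g - g * gr_elem K x * h.
  have brf : comb [seq (p.1, br p.2) | p <- ps] = br f.
    have br_scale d h : br (gr_single d 1%g * h) = gr_single d 1%g * br h.
      rewrite /br mulrBr; congr (_ - _); first by rewrite !mulrA.
      by rewrite mulrA -(gr_single_central d (g * gr_elem K x)) -!mulrA.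
    have brD h1 h2 : br (h1 + h2) = br h1 + br h2.
      by rewrite /br !mulrDl !mulrDr opprD addrACA.
    have br0 : br 0 = 0 by rewrite /br !mul0r mulr0 subrr.
    have brg : br g = 0 by rewrite /br subrr.
    rewrite comb_cons brD br_scale brg mulr0 add0r /comb big_map.
    rewrite (big_morph br brD br0); apply: eq_bigr => p _; exact: esym (br_scale _ _).
  apply: (IH [seq (p.1, br p.2) | p <- ps]).
  - by rewrite size_map.
  - move=> _ /mapP[p pps ->] z /=; rewrite gcoefD gcoefN; apply: rpredB;
      by apply: int_coef_mulJ => //; apply: int_ps'.
  - by rewrite brf; apply: JD; [apply/Jr/Jr | rewrite -mulNr; apply: Jl].
  - by rewrite brf subr_eq0.
have [d eg] : exists d, g = gr_single d 1%g * f.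
  apply: proportional_of_commutation => // x; apply/eqP/negPn/negP => nx.
  by apply: all_x; exists x.
by exists g => //; rewrite eg; apply: Jl.
Qed.

End IntegralElements.

Theorem theorem1p1 (G : groupType)
    (hfree : exists H : set G,
      [/\ free_subgroup H, nonabelian H & H #= [set: G]])
    (hstar : condition_star G) :
  (forall R : nzRingType, is_domain R -> [set: R] #<= [set: G] ->
     right_primitive (group_ring R G)) /\
  (forall K : fieldType, right_primitive (group_ring K G)).
Proof.
split=> [R dom cardR|K].
  have [f f_inj] : exists f : R -> G, injective f.
    move: cardR; rewrite /card_le => /asboolP[F].
    exists (fun c => val (F (exist _ c (mem_set I : c \in [set: R])))) => c d /val_inj.
    by move=> /(@inj _ _ _ F _ _ (in_setT _) (in_setT _))[].
  (* Here [G] is large enough to encode all of [R], and any nonzero element of the ideal will do. *)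
  apply: (@group_ring_primitive R G predT (fun c => (0%N, f c))) => //.
    by move=> c d _ _ [/f_inj].
  by move=> J _ _ _ _ [u Ju u0]; exists u.
(* One integer is chosen for each integral coefficient, which keeps the code injective in every
   characteristic. *)
have /choice[n nP] : forall c : K, exists n : int, c \in @int_coef K -> c = (n%:~R)%R.
  move=> c; have [/int_coefP[n ->]|_] := boolP (c \in @int_coef K); first by exists n.
  by exists 0%R.
apply: (@group_ring_primitive K G (@int_coef K) (fun c => (choice.pickle (n c), 1%g))) => //.
- by move=> x y /eqP; rewrite mulf_eq0.
- by move=> c d cD dD [/(pcan_inj (@choice.pickleK int)) e]; rewrite (nP _ cD) (nP _ dD) e.
- by move=> J; apply: exists_integral_elt.
Qed.
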